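(* There exist a virtually free group $G=A\ast_C B$, with $A$ and $B$ finite, and two elements $x,y\in G$ such that: (i) there exists an injective endomorphism $\phi:G\hookrightarrow G$ with $\phi(x)=y$ and $\phi(y)=x$ (in particular, $x$ and $y$ have the same existential type); (ii) no automorphism of $G$ maps $x$ to $y$.
   Context: A group is virtually free if it has a free subgroup of finite index. Two elements $x,y$ of a group $G$ have the same existential type if they satisfy in $G$ the same existential first-order formulas $\theta(t)$ with one free variable in the language of groups (formulas whose only quantifiers are $\exists$). *)

(* Defs.v *)
From HB Require Import structures.
From mathcomp Require Import all_boot all_fingroup.

Set Implicit Arguments.
Unset Strict Implicit.
Unset Printing Implicit Defensive.

Local Open Scope group_scope.

(** ** Free and virtually free groups *)

Definition free_basis (F : groupType) (X : Type) (b : X -> F) : Prop :=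
  forall (K : groupType) (f : X -> K),
    (exists h : {multiplicative F -> K}, forall x, h (b x) = f x) /\
    (forall h1 h2 : {multiplicative F -> K},
       (forall x, h1 (b x) = h2 (b x)) -> h1 =1 h2).

Definition free_group (F : groupType) : Prop :=
  exists (X : Type) (b : X -> F), free_basis b.

(* Finitely many left cosets of [S] cover [G]. *)
Definition finite_index (G : groupType) (S : {pred G}) : Prop :=
  exists r : seq G, forall g : G, exists2 t, t \in r & t^-1 * g \in S.

(* [F : subGroupType S] makes [S] a subgroup and [F] the group carried by it. *)
Definition virtually_free (G : groupType) : Prop :=
  exists (S : pred G) (F : subGroupType S), free_group F /\ finite_index S.

(** ** Amalgamated free products *)

(* [G] is the amalgam [A *_C B] with respect to the embeddings [iA], [iB]:
   the pushout, in the category of groups, of two injective morphisms. *)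
Definition amalgamated_product (A B C G : groupType)
    (iA : {multiplicative C -> A}) (iB : {multiplicative C -> B})
    (jA : {multiplicative A -> G}) (jB : {multiplicative B -> G}) : Prop :=
  [/\ injective iA, injective iB,
      forall c, jA (iA c) = jB (iB c)
    & forall (K : groupType)
        (fA : {multiplicative A -> K}) (fB : {multiplicative B -> K}),
        (forall c, fA (iA c) = fB (iB c)) ->
        (exists h : {multiplicative G -> K},
           (forall a, h (jA a) = fA a) /\ (forall b, h (jB b) = fB b)) /\
        (forall h1 h2 : {multiplicative G -> K},
           (forall a, h1 (jA a) = h2 (jA a)) ->
           (forall b, h1 (jB b) = h2 (jB b)) -> h1 =1 h2)].

(** ** First-order formulas in the language of groups *)

Inductive gterm (n : nat) : Type :=
  | GVar of 'I_n
  | GOne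
  | GMul of gterm n & gterm n
  | GInv of gterm n.

(* [gformula n]: formulas with free variables indexed by ['I_n].  A quantifier
   binds the variable [ord0] of its body; [lift ord0 i] is the outer [i]. *)
Inductive gformula : nat -> Type :=
  | GEq n of gterm n & gterm n : gformula n
  | GNot n of gformula n : gformula n
  | GAnd n of gformula n & gformula n : gformula n
  | GOr n of gformula n & gformula n : gformula n
  | GExists n of gformula n.+1 : gformula n
  | GForall n of gformula n.+1 : gformula n.

Fixpoint gterm_eval (G : groupType) n (e : 'I_n -> G) (t : gterm n) : G :=
  match t with
  | GVar i => e i
  | GOne => 1
  | GMul t1 t2 => gterm_eval e t1 * gterm_eval e t2
  | GInv t1 => (gterm_eval e t1)^-1
  end.

Definition env_cons (G : Type) n (g : G) (e : 'I_n -> G) (i : 'I_n.+1) : G :=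
  if unlift ord0 i is Some j then e j else g.

Fixpoint gholds (G : groupType) n (f : gformula n) : ('I_n -> G) -> Prop :=
  match f with
  | GEq _ t1 t2 => fun e => gterm_eval e t1 = gterm_eval e t2
  | GNot _ f1 => fun e => ~ gholds f1 e
  | GAnd _ f1 f2 => fun e => gholds f1 e /\ gholds f2 e
  | GOr _ f1 f2 => fun e => gholds f1 e \/ gholds f2 e
  | GExists _ f1 => fun e => exists g, gholds f1 (env_cons g e)
  | GForall _ f1 => fun e => forall g, gholds f1 (env_cons g e)
  end.

Fixpoint quantifier_free n (f : gformula n) : bool :=
  match f with
  | GEq _ _ _ => true
  | GNot _ f1 => quantifier_free f1
  | GAnd _ f1 f2 | GOr _ f1 f2 => quantifier_free f1 && quantifier_free f2
  | GExists _ _ | GForall _ _ => false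
  end.

(* The only quantifiers are existential; negation is applied to quantifier-free
   formulas only, since a negated [exists] is a universal quantifier. *)
Fixpoint existential n (f : gformula n) : bool :=
  match f with
  | GEq _ _ _ => true
  | GNot _ f1 => quantifier_free f1
  | GAnd _ f1 f2 | GOr _ f1 f2 => existential f1 && existential f2
  | GExists _ f1 => existential f1
  | GForall _ _ => false
  end.

Definition same_existential_type (G : groupType) (x y : G) : Prop :=
  forall theta : gformula 1, existential theta ->
    gholds theta (fun=> x) <-> gholds theta (fun=> y).

(* Main.v *)
Require Import Defs.
From HB Require Import structures.
From mathcomp Require Import all_boot all_fingroup all_algebra ring.

Set Implicit Arguments.
Unset Strict Implicit.
Unset Printing Implicit Defensive.

Import GRing.Theory.

(** The example is virtually cyclic. Let the infinite dihedral group, generated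
    by a rotation t of infinite order and a reflection a, act on the square C
    of the ring Z/35 by t (u, v) = (2u, v/2) and a (u, v) = (v, u), and let G
    be the semidirect product. The infinite dihedral group is the free product
    of the groups of order two generated by a and b = ta, so G is the amalgam
    over C of the finite groups C<a> and C<b> (lemma [sdihedral_amalgam]), and
    the infinite cyclic group of the rotations has finite index in it (lemma
    [sdihedral_virtually_free]).

    On C the rotation t has order 12: it acts with order 3 modulo 7 and with
    order 4 modulo 5. The point is that 7 is 1 modulo 3 and -1 modulo 4, so
    that 7 squares to 1 modulo 12 although it is neither 1 nor -1 there. Let
    theta be the involution of C which is the identity modulo 7 and exchanges
    the two coordinates modulo 5. It commutes with a, it conjugates the action
    of t to the action of t^7, and so it extends to an injective endomorphism
    phi of G with phi t = t^7 and phi a = a (lemmas [twistM] and [twist_inj]).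
    As phi^2 is the identity on C, it exchanges x = (1, 0) and y = theta x.
    Existential formulas go up along injective morphisms, so x and y have the
    same existential type.

    On the other hand an automorphism psi of G must send t to t or t^-1 up to
    an element of C (lemma [automorphism_rotation]). Since t x t^-1 = x^2, a
    psi with psi x = y would give t y t^-1 = y^2 or t^-1 y t = y^2. Both fail:
    t squares y modulo 7 but not modulo 5, and t^-1 does it modulo 5 but not
    modulo 7. *)

(** * Existential formulas and injective morphisms *)

Section GroupMorphisms.
Local Open Scope group_scope.
Variables (G H : groupType) (f : {multiplicative G -> H}).

Lemma mult1 : f 1 = 1.
Proof. by apply: (mulgI (f 1)); rewrite -gmulfM !mulg1. Qed.

Lemma multV : {morph f : x / x^-1}.
Proof. by move=> x; apply/esym/mulg1_eq; rewrite -gmulfM mulgV mult1. Qed.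

Lemma multX n : {morph f : x / x ^+ n}.
Proof.
by move=> x; elim: n => [|n IHn]; rewrite ?mult1 // !expgS gmulfM IHn.
Qed.

Definition mult_of (g : G -> H) (gM : {morph g : x y / x * y}) :
    {multiplicative G -> H} :=
  HB.pack_for {multiplicative G -> H} g (isMultiplicative.Build G H g gM).

End GroupMorphisms.

Section Formulas.
Local Open Scope group_scope.
Variables (G H : groupType) (phi : {multiplicative G -> H}).

Lemma gterm_eval_morph n (e : 'I_n -> G) (e' : 'I_n -> H) (t : gterm n) :
  (forall i, e' i = phi (e i)) -> gterm_eval e' t = phi (gterm_eval e t).
Proof.
move=> ee'; elim: t => [i||t1 IH1 t2 IH2|t1 IH1] /=; first exact: ee'.
- by rewrite mult1.
- by rewrite IH1 IH2 gmulfM.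
- by rewrite IH1 multV.
Qed.

Hypothesis phi_inj : injective phi.

(** The equivalence is needed, and not just one implication, because negation
    reverses implications. *)
Lemma gholds_quantifier_free n (f : gformula n) e e' :
  (forall i, e' i = phi (e i)) -> quantifier_free f ->
  gholds f e <-> gholds f e'.
Proof.
elim: f e e' => {n} /= [n t1 t2|n f IH|n f IHf g IHg|n f IHf g IHg|//|//] e e' ee'.
- move=> _; rewrite !(gterm_eval_morph _ ee').
  by split=> [->|/phi_inj].
- by move=> /(IH _ _ ee')[? ?]; split; auto.
- by case/andP=> /(IHf _ _ ee')[? ?] /(IHg _ _ ee')[? ?]; split; case; auto.
- by case/andP=> /(IHf _ _ ee')[? ?] /(IHg _ _ ee')[? ?]; split; case; auto.
Qed.

Lemma gholds_existential n (f : gformula n) e e' :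
  (forall i, e' i = phi (e i)) -> existential f -> gholds f e -> gholds f e'.
Proof.
elim: f e e' => {n} /= [n t1 t2|n f IH|n f IHf g IHg|n f IHf g IHg|n f IH|//]
  e e' ee'.
- by move=> _ eq12; rewrite !(gterm_eval_morph _ ee') eq12.
- by move=> /(gholds_quantifier_free ee')[? ?]; auto.
- by case/andP=> ? ? [? ?]; split; [apply: IHf ee' _ _|apply: IHg ee' _ _].
- by case/andP=> ? ? [?|?]; [left; apply: IHf ee' _ _|right; apply: IHg ee' _ _].
- (* The image of a witness is a witness. *)
  move=> ex_f [g fg]; exists (phi g); apply: IH fg => // i.
  by rewrite /env_cons; case: unliftP.
Qed.

End Formulas.

Lemma swap_same_existential_type (G : groupType) (x y : G)
    (phi : {multiplicative G -> G}) :
  injective phi -> phi x = y -> phi y = x -> same_existential_type x y.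
Proof.
move=> phi_inj xy yx theta ex_theta.
by split; apply: (gholds_existential phi_inj).
Qed.

(** * Integer powers in a group *)

(** Both implications are asked of the step, so that it can be run downwards
    to reach the negative integers. *)
Lemma int_ind_step (P : int -> Prop) :
  P 0%R -> (forall n, P n <-> P (n + 1)%R) -> forall n, P n.
Proof.
move=> P0 PS; elim=> // n Pn; first by rewrite -addn1 PoszD; apply: (PS _).1.
by apply: (PS _).2; rewrite -addn1 PoszD opprD addrNK.
Qed.

Section IntegerPowers.
Local Open Scope group_scope.

Definition expgz (G : groupType) (x : G) (n : int) : G :=
  match n with Posz m => x ^+ m | Negz m => x ^- m.+1 end.

Variable G : groupType.
Implicit Types (x y : G) (n m : int).

Lemma expgzD1 x n : expgz x (n + 1)%R = expgz x n * x.
Proof.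
case: n => [n|[|n]] /=.
- by rewrite addn1 expgSr.
- by rewrite expg1 mulVg.
- by rewrite subn1 [x ^+ n.+2]expgS invgM mulgVK.
Qed.

Lemma expgzD x n m : expgz x (n + m)%R = expgz x n * expgz x m.
Proof.
elim/int_ind_step: m => [|m]; first by rewrite addr0 mulg1.
rewrite addrA !expgzD1 mulgA; split=> [-> //|]; exact: mulIg.
Qed.

Lemma expgz1 x : expgz x 1 = x. Proof. by []. Qed.

Lemma expgzN x n : expgz x (- n)%R = (expgz x n)^-1.
Proof. by apply/esym/mulg1_eq; rewrite -expgzD subrr. Qed.

Lemma expgz_invert x y n : y * x = x^-1 * y ->
  y * expgz x n = expgz x (- n)%R * y.
Proof.
move=> yx; elim/int_ind_step: n => [|n]; first by rewrite mulg1 mul1g.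
have ->: expgz x (- (n + 1))%R * y = expgz x (- n)%R * y * x.
  by rewrite opprD expgzD (expgzN x 1) expgz1 -!mulgA yx.
by rewrite expgzD1 mulgA; split=> [-> //|]; apply: mulIg.
Qed.

(** If moving [x] past the values of [f] costs one step of an action [s] of the
    integers, then moving [expgz x n] costs [n] steps. Invertibility of the
    action is what allows the descent to negative [n]. *)
Lemma expgz_intertwine (T : Type) (f : T -> G) (s : int -> T -> T) x :
    (forall c, s 0%R c = c) -> (forall n m c, s n (s m c) = s (n + m)%R c) ->
    (forall c, x * f c = f (s 1%R c) * x) ->
  forall n c, expgz x n * f c = f (s n c) * expgz x n.
Proof.
move=> s0 sD xf; elim/int_ind_step=> [c|n]; first by rewrite s0 mulg1 mul1g.
split=> IH c; first by rewrite expgzD1 -mulgA xf mulgA IH sD mulgA.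
have /mulIg: expgz x n * f c * x = f (s n c) * expgz x n * x; last by [].
have := IH (s (-1)%R c); rewrite expgzD1 sD addrK -!mulgA => <-.
by rewrite xf sD subrr s0.
Qed.

End IntegerPowers.

Lemma mult_expgz (G H : groupType) (f : {multiplicative G -> H}) x n :
  f (expgz x n) = expgz (f x) n.
Proof. by case: n => n /=; rewrite ?multV multX. Qed.

(** * The semidirect product of a square by the infinite dihedral group *)

(** The triple [(c, n, e)] stands for [c * t ^ n * a ^ e], where [c] is in the
    square of [R], the rotation [t] multiplies the first coordinate by [q] and
    the second by its inverse, and the reflection [a] exchanges coordinates.
    The unit [q] appears in the type because the group law depends on it. *)
Definition sdihedral (R : finComUnitRingType) (q : {unit R}) : Type :=
  ((R * R) * int * bool)%type.

(** The pair [(c, e)] stands for [c * (t ^ i * a) ^ e]: this is the finite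
    subgroup of [sdihedral q] generated by the square of [R] and by one
    reflection. *)
Definition vertex (R : finComUnitRingType) (q : {unit R}) (i : int) : Type :=
  ((R * R) * bool)%type.

Section Dihedral.
Variables (R : finComUnitRingType) (q : {unit R}).
Local Open Scope ring_scope.
Implicit Types (c : (R * R)%type) (n m : int) (e : bool).

Definition sgz_of e n : int := if e then - n else n.
Definition swap e c : (R * R)%type := if e then (c.2, c.1) else c.
Definition rot n c : (R * R)%type :=
  (val (expgz q n) * c.1, val (expgz q (- n)) * c.2).

Lemma swapD e c c' : swap e (c + c') = swap e c + swap e c'.
Proof. by case: e. Qed.
Lemma rotD n c c' : rot n (c + c') = rot n c + rot n c'.
Proof. by rewrite /rot /= !mulrDr. Qed.
Lemma rot_rot n m c : rot n (rot m c) = rot (n + m) c.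
Proof. by rewrite /rot /= opprD !expgzD /= !mulrA. Qed.
Lemma rot0 c : rot 0 c = c.
Proof. by case: c => u v; rewrite /rot /= !mul1r. Qed.
Lemma swap_rot e n c : swap e (rot n c) = rot (sgz_of e n) (swap e c).
Proof. by case: e; rewrite /rot //= opprK. Qed.
Lemma swap_swap e f c : swap e (swap f c) = swap (e (+) f) c.
Proof. by case: e f c => [] [] []. Qed.
Lemma sgz_ofD e n m : sgz_of e (n + m) = sgz_of e n + sgz_of e m.
Proof. by case: e; rewrite //= opprD. Qed.
Lemma sgz_of_sgz e f n : sgz_of e (sgz_of f n) = sgz_of (e (+) f) n.
Proof. by case: e f => [] [] //=; rewrite opprK. Qed.
Lemma swap0 e : swap e 0 = 0. Proof. by case: e. Qed.
Lemma rot00 n : rot n 0 = 0. Proof. by rewrite /rot /= !mulr0. Qed.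
Lemma swapN e c : swap e (- c) = - swap e c. Proof. by case: e. Qed.
Lemma rotN n c : rot n (- c) = - rot n c.
Proof. by rewrite /rot /= !mulrN. Qed.

Local Notation sdihedral := (sdihedral q).
HB.instance Definition _ := Choice.copy sdihedral ((R * R) * int * bool)%type.
Implicit Types x y : sdihedral.

Definition sd_mul x y : sdihedral :=
  (x.1.1 + rot x.1.2 (swap x.2 y.1.1), x.1.2 + sgz_of x.2 y.1.2, x.2 (+) y.2).
Definition sd_one : sdihedral := (0, 0, false).
Definition sd_inv x : sdihedral :=
  (- swap x.2 (rot (- x.1.2) x.1.1), - sgz_of x.2 x.1.2, x.2).

Lemma sd_mulA : associative sd_mul.
Proof.
move=> [[c n] e] [[c' n'] e'] [[c2 n2] e2]; rewrite /sd_mul /=.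
by rewrite swapD rotD swap_rot rot_rot swap_swap sgz_ofD sgz_of_sgz !addrA addbA.
Qed.
Lemma sd_mul1 : left_id sd_one sd_mul.
Proof. by move=> [[c n] e]; rewrite /sd_mul /= rot0 !add0r. Qed.
Lemma sd_mulx1 : right_id sd_one sd_mul.
Proof.
move=> [[c n] e]; rewrite /sd_mul /= swap0 rot00 addr0 addbF.
by case: e; rewrite /= ?oppr0 addr0.
Qed.
Lemma sd_mulV : left_inverse sd_one sd_inv sd_mul.
Proof.
move=> [[c n] e]; rewrite /sd_mul /= addbb swap_rot addNr.
by case: e; rewrite /sgz_of /= ?opprK addNr.
Qed.
Lemma sd_mulxV : right_inverse sd_one sd_inv sd_mul.
Proof.
move=> [[c n] e]; rewrite /sd_mul /= addbb swapN swap_swap addbb /= rotN rot_rot.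
by case: e; rewrite /sgz_of /= ?opprK !subrr rot0 subrr.
Qed.
HB.instance Definition _ := isGroup.Build sdihedral
  sd_mulA sd_mul1 sd_mulx1 sd_mulV sd_mulxV.

Local Open Scope group_scope.

Lemma sd_mulE x y : x * y =
  (x.1.1 + rot x.1.2 (swap x.2 y.1.1), x.1.2 + sgz_of x.2 y.1.2, x.2 (+) y.2)%R.
Proof. by []. Qed.

Definition translation c : sdihedral := (c, 0%R, false).
Definition rotation : sdihedral := (0%R, 1%R, false).
Definition reflection : sdihedral := (0%R, 0%R, true).

Lemma translationD c c' :
  translation (c + c')%R = translation c * translation c'.
Proof. by rewrite sd_mulE /= rot0 addr0. Qed.

Lemma translation_commute d n c :
  ((d, n, false) : sdihedral) * translation c =
    translation (rot n c) * (d, n, false).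
Proof. by rewrite !sd_mulE /= rot0 addr0 add0r addrC. Qed.

Lemma expgz_rotation n : expgz rotation n = (0%R, n, false).
Proof.
elim/int_ind_step: n => // n; rewrite expgzD1.
have ->: (0%R, (n + 1)%R, false) = ((0%R, n, false) : sdihedral) * rotation.
  by rewrite sd_mulE /= rot00 addr0.
by split=> [->|/mulIg].
Qed.

Lemma sdihedralE c n e :
  (c, n, e) = translation c * expgz rotation n * reflection ^+ e :> sdihedral.
Proof.
rewrite expgz_rotation.
by case: e; rewrite /= ?expg1 ?mulg1 !sd_mulE /= ?rot00 ?rot0 ?addr0 ?add0r.
Qed.

(** * The amalgam decomposition *)

Local Notation vertex := (vertex q).
HB.instance Definition _ i := Finite.copy (vertex i) ((R * R) * bool)%type.

Section Vertex.
Variable i : int.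
Implicit Types a b : vertex i.

(* The exponent of the rotation in [(t ^ i * a) ^ e]. *)
Definition vshift e : int := if e then i else 0%R.
Definition vmul a b : vertex i :=
  (a.1 + rot (vshift a.2) (swap a.2 b.1), a.2 (+) b.2)%R.
Definition vone : vertex i := (0%R, false).
Definition vinv a : vertex i :=
  (- rot (vshift a.2) (swap a.2 a.1), a.2)%R.
Definition vincl a : sdihedral := (a.1, vshift a.2, a.2).

Lemma vincl_inj : injective vincl.
Proof. by move=> [c e] [c' e'] [-> _ ->]. Qed.
Lemma vinclM : {morph vincl : a b / vmul a b >-> a * b}.
Proof.
move=> [c e] [c' e']; rewrite sd_mulE /vincl /vmul /=.
by case: e e' => [] [] /=; rewrite ?subrr ?oppr0 ?addr0 ?add0r.
Qed.
Lemma vincl1 : vincl vone = 1. Proof. by []. Qed.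
Lemma vinclV a : vincl (vinv a) = (vincl a)^-1.
Proof.
case: a => c e; rewrite /vincl /=.
have -> z : z^-1 = sd_inv z by [].
by rewrite /sd_inv /= swap_rot; case: e; rewrite /= ?opprK ?oppr0.
Qed.

Lemma vmulA : associative vmul.
Proof. by move=> a b c; apply: vincl_inj; rewrite !vinclM mulgA. Qed.
Lemma vmul1 : left_id vone vmul.
Proof. by move=> a; apply: vincl_inj; rewrite vinclM vincl1 mul1g. Qed.
Lemma vmulV : left_inverse vone vinv vmul.
Proof. by move=> a; apply: vincl_inj; rewrite vinclM vinclV vincl1 mulVg. Qed.
HB.instance Definition _ := Finite_isGroup.Build (vertex i) vmulA vmul1 vmulV.
HB.instance Definition _ :=
  isMultiplicative.Build (vertex i) sdihedral vincl vinclM.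

Definition edge_incl (c : (R * R)%type) : vertex i := (c, false).
Lemma edge_inclM : {morph edge_incl : c c' / c * c'}.
Proof.
by move=> c c'; rewrite /edge_incl; congr (_, _); rewrite /= rot0.
Qed.
HB.instance Definition _ :=
  isMultiplicative.Build (R * R)%type (vertex i) edge_incl edge_inclM.

End Vertex.

(** Morphisms [fA] and [fB] that agree on the square of [R] send the reflections
    [a] and [b = t * a] to involutions, and a product of two involutions is
    inverted by each of them. So the images of the translations, of [t] and of
    [a] satisfy the commutation rules that define the group law of the triples,
    and the common extension is read off the normal form [c * t ^ n * a ^ e]. *)
Lemma sdihedral_amalgam :
  amalgamated_product (@edge_incl 0) (@edge_incl 1) (@vincl 0) (@vincl 1).
Proof.
split=> [c c' []|c c' []||K fA fB fAB] //.
pose F (c : (R * R)%type) := fA (edge_incl 0 c).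
pose a := fA (0%R, true); pose b := fB (0%R, true); pose t := b * a.
have FD c c' : F (c + c')%R = F c * F c' by rewrite -!gmulfM.
have a2 : a * a = 1.
  rewrite -gmulfM -[RHS](mult1 fA); congr (fA _).
  by congr (_, _); rewrite /= rot0 addr0.
have b2 : b * b = 1.
  rewrite -gmulfM -[RHS](mult1 fB); congr (fB _).
  by congr (_, _); rewrite /= rot00 addr0.
have aF c : a * F c = F (swap true c) * a.
  rewrite -!gmulfM; congr (fA _); congr (_, _).
  by rewrite /= rot0 rot0 addr0 add0r.
have bF c : b * F c = F (rot 1 (swap true c)) * b.
  rewrite /F !fAB -!gmulfM; congr (fB _); congr (_, _).
  by rewrite /= rot0 addr0 add0r.
have tF c : t * F c = F (rot 1 c) * t.
  by rewrite /t -mulgA aF mulgA bF swap_swap mulgA.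
have tzF n c : expgz t n * F c = F (rot n c) * expgz t n.
  by apply: expgz_intertwine => [?|? ? ?|]; rewrite ?rot0 ?rot_rot.
have at1 : a * t = t^-1 * a.
  have ->: t^-1 = a * b.
    by apply: mulg1_eq; rewrite mulgA -(mulgA b) a2 mulg1 b2.
  by rewrite /t mulgA.
have atz n : a * expgz t n = expgz t (- n)%R * a by exact: expgz_invert.
have aeF (e : bool) c : a ^+ e * F c = F (swap e c) * a ^+ e.
  by case: e => /=; rewrite ?mulg1 ?mul1g // !expg1 aF.
have aetz (e : bool) n : a ^+ e * expgz t n = expgz t (sgz_of e n) * a ^+ e.
  by case: e => /=; rewrite ?mulg1 ?mul1g // !expg1 atz.
have aae (e f : bool) : a ^+ e * a ^+ f = a ^+ (e (+) f).
  by case: e f => [] [] /=; rewrite ?mulg1 ?mul1g // !expg1 a2.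
pose h (x : sdihedral) := F x.1.1 * expgz t x.1.2 * a ^+ x.2.
have hM : {morph h : x y / x * y}.
  move=> [[c n] e] [[c' n'] e']; rewrite sd_mulE /h /=.
  rewrite FD expgzD -aae !mulgA; congr (_ * _).
  rewrite -[LHS]mulgA -aetz mulgA; congr (_ * _).
  by rewrite -(mulgA (F c)) -tzF !mulgA -[RHS]mulgA aeF mulgA.
split.
  exists (mult_of hM); split=> [[c e]|[c e]] /=; rewrite /h /=.
    have ->: (c, e) = edge_incl 0 c * (0%R, e) :> vertex 0.
      by congr (_, _); rewrite /= rot0 addr0.
    rewrite gmulfM /vshift if_same mulg1; congr (_ * _).
    by case: e; rewrite //= (mult1 fA).
  have ->: (c, e) = edge_incl 1 c * (0%R, e) :> vertex 1.
    by congr (_, _); rewrite /= rot0 addr0.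
  rewrite gmulfM -fAB -mulgA; congr (_ * _).
  case: e => /=; last by rewrite mulg1 (mult1 fB).
  by rewrite /t -mulgA a2 mulg1.
move=> h1 h2 h12A h12B [[c n] e]; rewrite sdihedralE.
have ->: rotation =
    vincl ((0%R, true) : vertex 1) * vincl ((0%R, true) : vertex 0).
  by rewrite sd_mulE /= rot00 oppr0 !addr0.
rewrite !gmulfM !(multX, mult_expgz) !gmulfM h12B (h12A (0%R, true)).
by rewrite (h12A (edge_incl 0 c)).
Qed.

(** * Virtual freeness *)

Definition is_rotation : {pred sdihedral} := fun x => (x.1.1 == 0%R) && ~~ x.2.

Lemma is_rotationP x : reflect (x = expgz rotation x.1.2) (x \in is_rotation).
Proof.
case: x => [[c n] e]; rewrite expgz_rotation.
by apply: (iffP andP) => [[/= /eqP-> /negPf->]|[-> ->]].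
Qed.

Lemma is_rotation_closed : group_closed is_rotation.
Proof.
split=> [|x y /is_rotationP->]; first by apply/andP.
move=> /is_rotationP->; rewrite -expgzN -expgzD.
by apply/is_rotationP; rewrite !expgz_rotation.
Qed.

Definition rotations : Type := {x : sdihedral | x \in is_rotation}.
HB.instance Definition _ := SubChoice.copy rotations {x | x \in is_rotation}.
HB.instance Definition _ :=
  SubChoice_isSubGroup.Build sdihedral is_rotation rotations is_rotation_closed.

(** The rotations form an infinite cyclic group, which is free on [rotation],
    and the elements [(c, 0, e)] represent its left cosets. *)
Lemma sdihedral_virtually_free : virtually_free sdihedral.
Proof.
exists is_rotation, rotations; split; last first.
  exists [seq (z.1, 0%R, z.2) | z : (R * R) * bool] => -[[c n] e].
  exists (c, 0%R, e); first by apply: image_f (c, e) _.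
  have ->: (c, n, e) = ((c, 0%R, e) : sdihedral) * (0%R, sgz_of e n, false).
    by rewrite sd_mulE /= swap0 rot00 addr0 add0r sgz_of_sgz addbb addbF.
  by rewrite mulKg; apply/andP.
have rotS : rotation \in is_rotation by apply/andP.
exists unit, (fun _ => Sub rotation rotS : rotations) => K f; split.
  pose g (x : rotations) := expgz (f tt) (val x).1.2.
  have gM : {morph g : x y / x * y}.
    move=> [x xS] [y yS]; rewrite /g valM /= -expgzD; congr expgz.
    by case/andP: xS => _ /negPf->.
  by exists (mult_of gM); case.
move=> h1 h2 h12 x.
have ->: x = expgz (Sub rotation rotS : rotations) (val x).1.2.
  by apply: val_inj; rewrite (mult_expgz val) /=; apply/is_rotationP/(valP x).
by rewrite !mult_expgz (h12 tt).
Qed.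

(** * A twisted endomorphism *)

Section Twist.
Variables (p : R) (j : int).
Local Open Scope ring_scope.
Hypotheses (p_idem : p * p = p) (j_neq0 : j != 0).
(* The idempotent [p] splits [R] into two factors: on the first one [q ^ j] is
   [q], and on the second one it is the inverse of [q]. *)
Hypothesis j_p : p * val (expgz q j) = p * val (expgz q 1).
Hypothesis j_p' : (1 - p) * val (expgz q j) = (1 - p) * val (expgz q (- 1)).

(** On the first factor of [R] this is the identity, and on the second one it
    exchanges the two coordinates. *)
Definition blend c : (R * R)%type :=
  (p * c.1 + (1 - p) * c.2, (1 - p) * c.1 + p * c.2).
Definition twist x : sdihedral := (blend x.1.1, j * x.1.2, x.2).

Lemma blendK : involutive blend.
Proof.
case=> u v; rewrite /blend /=; congr (_, _).
  transitivity (u + 2%:R * (p * p - p) * (u - v)); first by ring.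
  by rewrite p_idem subrr mulr0 mul0r addr0.
transitivity (v + 2%:R * (p * p - p) * (v - u)); first by ring.
by rewrite p_idem subrr mulr0 mul0r addr0.
Qed.

Lemma twist_inj : injective twist.
Proof.
move=> [[c n] e] [[c' n'] e'] [] /= cc1 cc2 /(mulfI j_neq0) -> ->.
by rewrite -(blendK c) -(blendK c') /blend cc1 cc2.
Qed.

Lemma expgz_val_eq (s : R) i k :
    s * val (expgz q i) = s * val (expgz q k) ->
  forall n, s * val (expgz q (i * n)) = s * val (expgz q (k * n)).
Proof.
move=> ik; elim/int_ind_step=> [|n]; first by rewrite !mulr0.
rewrite !mulrDr !mulr1 !expgzD !FinRing.val_unitM ![val (_ (_ * n)) * _]mulrC.
rewrite !mulrA ik -!mulrA ![val (expgz q k) * _]mulrC !mulrA.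
split=> [-> //|]; apply: mulIr; exact: valP.
Qed.

(** Exchanging the coordinates conjugates the rotation to its inverse, and
    [q ^ j] is the inverse of [q] precisely on the factor of [R] where [blend]
    makes this exchange. *)
Lemma blend_rot n c : blend (rot n c) = rot (j * n) (blend c).
Proof.
have Ep m : p * val (expgz q (j * m)) = p * val (expgz q m).
  by rewrite (expgz_val_eq j_p) mul1r.
have Ep' m : (1 - p) * val (expgz q (j * m)) = (1 - p) * val (expgz q (- m)).
  by rewrite (expgz_val_eq j_p') mulN1r.
rewrite /blend /rot -mulrN; congr (_, _).
  by rewrite mulrDr !mulrA ![val _ * p]mulrC ![val _ * (1 - p)]mulrC Ep Ep'.
rewrite mulrDr !mulrA ![val _ * p]mulrC ![val _ * (1 - p)]mulrC Ep Ep'.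
by rewrite opprK.
Qed.

Lemma twistM : {morph twist : x y / (x * y)%g}.
Proof.
have blendD : {morph blend : c c' / c + c'}.
  by move=> c c'; congr (_, _); rewrite /= !mulrDr addrACA.
move=> [[c n] e] [[c' n'] e']; rewrite !sd_mulE /twist /= blendD blend_rot.
congr (_ + rot _ _, _, _); last by rewrite mulrDr; case: e; rewrite /= ?mulrN.
by case: e => //; rewrite /blend /= addrC [p * _ + _]addrC.
Qed.

End Twist.

(** * Automorphisms *)

Section Automorphisms.
Implicit Type g : sdihedral.

Lemma sd_expg2 g k : (g ^+ k).2 = odd k && g.2.
Proof.
elim: k => // k IHk; rewrite expgS sd_mulE /= IHk.
by case: g.2; case: odd.
Qed.

Lemma sd_expgz12 g n : ~~ g.2 ->
  (expgz g n).2 = false /\ (expgz g n).1.2 = (g.1.2 * n)%R.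
Proof.
move=> /negPf g2; elim/int_ind_step: n => [|n]; first by rewrite mulr0.
rewrite expgzD1 sd_mulE /= g2 addbF.
by split=> -[-> /=]; rewrite mulrDr mulr1; [move=> ->|move/addIr->].
Qed.

Lemma sd_torsion g k : (0 < k)%N -> ~~ g.2 -> g ^+ k = 1 -> g.1.2 = 0%R.
Proof.
case: k => // k _ g2 gk; have [_] := sd_expgz12 k.+1 g2.
by rewrite /= gk => /esym/eqP; rewrite mulf_eq0 orbF => /eqP.
Qed.

Variable N : nat.
Hypotheses (N_odd : odd N) (N0 : N%:R = 0%R :> R).

Lemma translation_expg c : translation c ^+ N = 1.
Proof.
have cX k : translation c ^+ k = translation (c *+ k)%R.
  by elim: k => // k IHk; rewrite expgS IHk sd_mulE /= rot0 -mulrS.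
rewrite cX; congr translation; case: c {cX} => u v.
by rewrite pairMnE /= -mulr_natr -[(v *+ N)%R]mulr_natr N0 !mulr0.
Qed.

(** The reflection part of [g] reverses the second rotation part in [g ^+ 2],
    which is therefore a translation. *)
Lemma reflection_expg g : g.2 -> g ^+ (2 * N) = 1.
Proof.
case: g => [[c n] e] /= ->; rewrite expgnA expg2 sd_mulE /= subrr.
exact: translation_expg.
Qed.

Lemma rotation_expg : rotation ^+ (2 * N) != 1.
Proof.
apply/eqP=> /sd_torsion; rewrite muln_gt0 /=.
by case: N N_odd => // n _ /(_ isT isT).
Qed.

(** The exponent [2 * N] kills the elements [g] with [g.2], but not the
    rotation, so neither the image nor the preimage of the rotation is one of
    them. The exponent [N] kills the translations; as it is odd, their images
    have no reflection part and, being of finite order, no rotation part. Hence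
    [psi] multiplies the exponent of the rotation by a constant, which must be
    invertible for the rotation to be in the image of [psi]. *)
Lemma automorphism_rotation (psi : {multiplicative sdihedral -> sdihedral}) :
  bijective psi ->
  exists c, psi rotation = (c, 1%R, false) \/ psi rotation = (c, (-1)%R, false).
Proof.
move=> /[dup]/bij_inj psi_inj [psi' psiK psi'K].
have N_gt0 : (0 < N)%N by case: N N_odd.
have torsion g : g ^+ (2 * N) = 1 <-> psi g ^+ (2 * N) = 1.
  rewrite -multX; split=> [->|gN]; first exact: mult1.
  by apply: psi_inj; rewrite gN mult1.
have rotF g : psi g = rotation -> ~~ g.2.
  move=> psig; apply/negP=> /reflection_expg/torsion; rewrite psig.
  exact/eqP/rotation_expg.
have psi_rotF : ~~ (psi rotation).2.
  by apply/negP=> /reflection_expg/(torsion _).2; apply/eqP/rotation_expg.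
have psi_transF c :
    ~~ (psi (translation c)).2 /\ (psi (translation c)).1.2 = 0%R.
  have psiN : psi (translation c) ^+ N = 1.
    by rewrite -multX translation_expg mult1.
  have F : ~~ (psi (translation c)).2.
    by have := sd_expg2 (psi (translation c)) N; rewrite psiN N_odd /= => <-.
  by split=> //; apply: sd_torsion psiN.
(* Compare exponents of the rotation in the preimage of the rotation. *)
move: (psi'K rotation) => /[dup]/rotF; case: (psi' _) => [[c n] e] /= /negPf->.
rewrite sdihedralE mulg1 gmulfM mult_expgz sd_mulE.
have [/negPf-> ->] := psi_transF c; rewrite add0r /=.
have [_ ->] := sd_expgz12 n psi_rotF.
move=> /(congr1 (fun x : sdihedral => `|x.1.2|%N)) /=.
case: (psi rotation) psi_rotF => [[d m] f] /= /negPf->.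
rewrite abszM => /eqP; rewrite muln_eq1 => /andP[/eqP m1 _].
by exists d; case: m m1 => [m|m] /= [->]; [left|right].
Qed.

End Automorphisms.

End Dihedral.

(** * The example *)

Section Example.
Local Open Scope ring_scope.

Definition q35 : {unit 'Z_35} := Sub (2%:R : 'Z_35) isT.

(** The idempotent of Z/35 which is 1 modulo 7 and 0 modulo 5. *)
Definition p35 : 'Z_35 := 15%:R.

Lemma p35_idem : p35 * p35 = p35.
Proof. exact: val_inj. Qed.

Lemma expq35_p : p35 * val (expgz q35 7) = p35 * val (expgz q35 1).
Proof. exact: val_inj. Qed.

Lemma expq35_p' :
  (1 - p35) * val (expgz q35 7) = (1 - p35) * val (expgz q35 (- 1)).
Proof. exact: val_inj. Qed.

Definition phi35 : {multiplicative sdihedral q35 -> sdihedral q35} :=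
  mult_of (twistM expq35_p expq35_p').

Definition x35 : sdihedral q35 := translation q35 (1, 0).
Definition y35 : sdihedral q35 := translation q35 (p35, 1 - p35).

Lemma phi35_inj : injective phi35.
Proof. exact: twist_inj p35_idem _. Qed.

Lemma phi35_x : phi35 x35 = y35.
Proof. by rewrite /= /twist /blend /= !mulr1 !mulr0 !addr0. Qed.

Lemma phi35_y : phi35 y35 = x35.
Proof. by rewrite -phi35_x /= /twist /= (blendK p35_idem). Qed.

(** An automorphism carries the relation [t * x = x ^ 2 * t] to a relation
    between [y] and a rotation of exponent 1 or -1; the two computations at the
    end refute it on one coordinate of [y] each. *)
Lemma no_automorphism35 (psi : {multiplicative sdihedral q35 -> sdihedral q35}) :
  bijective psi -> psi x35 <> y35.
Proof.
move=> psi_bij psi_x.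
have rot_x : (rotation q35 * x35 = x35 * x35 * rotation q35)%g.
  rewrite translation_commute -translationD; congr (translation _ _ * _)%g.
  exact/eqP.
have N0 : 35%:R = 0 :> 'Z_35 by apply: val_inj.
have rot_y d n : psi (rotation q35) = (d, n, false) ->
    rot q35 n (p35, 1 - p35) = (p35 + p35, (1 - p35) + (1 - p35)).
  move=> psi_r; have := congr1 psi rot_x.
  rewrite !gmulfM psi_x psi_r translation_commute => /mulIg.
  by rewrite -translationD => /(congr1 (fun g : sdihedral q35 => g.1.1)); exact.
have [d [/rot_y|/rot_y]] := automorphism_rotation (isT : odd 35) N0 psi_bij.
  by apply/eqP; vm_compute.
by apply/eqP; vm_compute.
Qed.

End Example.

Theorem proposition1p5 :
  exists (A B C : finGroupType) (G : groupType)
         (iA : {multiplicative C -> A}) (iB : {multiplicative C -> B})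
         (jA : {multiplicative A -> G}) (jB : {multiplicative B -> G}),
    amalgamated_product iA iB jA jB /\
    virtually_free G /\
    exists x y : G,
      (exists phi : {multiplicative G -> G},
         [/\ injective phi, phi x = y & phi y = x]) /\
      same_existential_type x y /\
      ~ (exists psi : {multiplicative G -> G}, bijective psi /\ psi x = y).
Proof.
exists (vertex q35 0), (vertex q35 1), ('Z_35 * 'Z_35)%type, (sdihedral q35).
do 4!eexists; split; first exact: sdihedral_amalgam.
split; first exact: sdihedral_virtually_free.
exists x35, y35; split.
  by exists phi35; split; [apply: phi35_inj|apply: phi35_x|apply: phi35_y].
split; last by case=> psi [/no_automorphism35].
exact: swap_same_existential_type phi35_inj phi35_x phi35_y.
Qed.
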